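(* Let $Q$ be a connected quiver associated to an antisymmetric integer matrix $(\kappa_{ij})_{1\le i,j\le n}$. If $Q$ admits a scaling solution or an attractor solution, then $Q$ is strongly connected.
   Context: Let $\kappa=(\kappa_{ij})_{1\le i,j\le n}$ be an antisymmetric matrix of integers. The associated quiver $Q$ has set of nodes $Q_0=\{1,\dots,n\}$ and, for each pair $(i,j)$ with $\kappa_{ij}>0$, exactly $\kappa_{ij}$ arrows from $i$ to $j$ (so $Q$ has no loops and no oriented 2-cycles). $Q$ is connected if its underlying unoriented graph is connected. $Q$ is strongly connected if for any two nodes $i,j$ there is an oriented path from $i$ to $j$ and an oriented path from $j$ to $i$. A configuration of centers is a family of points $\vec r_1,\dots,\vec r_n\in\mathbb{R}^3$ with $\vec r_i\ne \vec r_j$ whenever $\kappa_{ij}\neq 0$; write $r_{ij}=|\vec r_i-\vec r_j|$. Terms with $\kappa_{ij}=0$ are omitted from the sums below. A scaling solution is a configuration satisfying $\sum_{j\ne i}\kappa_{ij}/r_{ij}=0$ for all $i=1,\dots,n$. An attractor solution is a configuration satisfying $\sum_{j\neq i}\kappa_{ij}\left(1+1/r_{ij}\right)=0$ for all $i=1,\dots,n$. *)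

(* Defs.v *)
(** Finite quivers attached to antisymmetric integer matrices, and their
    scaling and attractor solutions (Mathematical Components). *)
From HB Require Import structures.
From mathcomp Require Import all_boot all_order all_algebra.
From mathcomp Require Import reals.

Set Implicit Arguments.
Unset Strict Implicit.
Unset Printing Implicit Defensive.

Import Order.TTheory GRing.Theory Num.Theory.
Local Open Scope ring_scope.

Record quiver := Quiver {
  node : finType;
  arrow : finType;
  source : arrow -> node;
  target : arrow -> node }.

Definition has_arrow (Q : quiver) : rel (node Q) :=
  [rel i j | [exists a : arrow Q, (source a == i) && (target a == j)]].

Definition quiver_connected (Q : quiver) : Prop :=
  forall i j : node Q,
    connect [rel x y | has_arrow x y || has_arrow y x] i j.

(** [connect] is reflexive: the path of length zero counts as an oriented path
    from a node to itself. *)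
Definition strongly_connected (Q : quiver) : Prop :=
  forall i j : node Q,
    connect (@has_arrow Q) i j /\ connect (@has_arrow Q) j i.

Definition antisymmetric_mx (n : nat) (kappa : 'M[int]_n) : Prop :=
  forall i j : 'I_n, kappa i j = - kappa j i.

Definition num_arrows (n : nat) (kappa : 'M[int]_n) (ij : 'I_n * 'I_n) : nat :=
  if 0 < kappa ij.1 ij.2 then `|kappa ij.1 ij.2|%N else 0%N.

(** An arrow is a pair of nodes [(i, j)] together with a label in
    ['I_(num_arrows kappa (i, j))]. *)
Definition quiver_of (n : nat) (kappa : 'M[int]_n) : quiver :=
  @Quiver 'I_n {ij : 'I_n * 'I_n & 'I_(num_arrows kappa ij)}
    (fun a => (tag a).1) (fun a => (tag a).2).

(** The library norm on ['rV[R]_3] is the sup norm, hence an explicit Euclidean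
    distance. *)
Definition edist (R : realType) (x y : 'rV[R]_3) : R :=
  Num.sqrt (\sum_(k < 3) (x 0 k - y 0 k) ^+ 2).

Definition configuration (R : realType) (n : nat) (kappa : 'M[int]_n)
    (r : 'I_n -> 'rV[R]_3) : Prop :=
  forall i j : 'I_n, kappa i j != 0 -> r i <> r j.

Definition scaling_solution (R : realType) (n : nat) (kappa : 'M[int]_n)
    (r : 'I_n -> 'rV[R]_3) : Prop :=
  configuration kappa r /\
  forall i : 'I_n,
    \sum_(j < n | (j != i) && (kappa i j != 0))
      (kappa i j)%:~R / edist (r i) (r j) = 0.

Definition attractor_solution (R : realType) (n : nat) (kappa : 'M[int]_n)
    (r : 'I_n -> 'rV[R]_3) : Prop :=
  configuration kappa r /\
  forall i : 'I_n,
    \sum_(j < n | (j != i) && (kappa i j != 0))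
      (kappa i j)%:~R * (1 + 1 / edist (r i) (r j)) = 0.

(* Main.v *)
(** A solution of either kind is a circulation: weighting each pair of nodes by
    [kappa i j / r_ij] (or [kappa i j (1 + 1 / r_ij)]) gives an antisymmetric
    function with the sign of [kappa] and vanishing net flow at each node. The
    net flow out of a set closed under arrows is then zero, although all its
    terms are nonpositive, so no arrow enters the set either. Applied to the
    nodes reachable from the target of an arrow, this puts every arrow on an
    oriented cycle. *)
Require Import Defs.
From HB Require Import structures.
From mathcomp Require Import all_boot all_order all_algebra.
From mathcomp Require Import reals.

Set Implicit Arguments.
Unset Strict Implicit.
Unset Printing Implicit Defensive.

Import Order.TTheory GRing.Theory Num.Theory.
Local Open Scope ring_scope.

Lemma sum_antisymmetric (R : numDomainType) (T : finType) (A : {pred T})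
    (F : T -> T -> R) :
  (forall x y, F x y = - F y x) -> \sum_(x in A) \sum_(y in A) F x y = 0.
Proof.
(* Swapping the two summations shows that the sum equals its own opposite. *)
move=> antiF; apply/eqP; rewrite -eqNr; apply/eqP.
rewrite [RHS]exchange_big -sumrN; apply: eq_bigr => x _.
by rewrite -sumrN; apply: eq_bigr => y _; rewrite [in RHS]antiF.
Qed.

(** The zero net flows of the nodes of [A] add up to zero, and the flow between nodes of [A] cancels
    in antisymmetric pairs; only the flow leaving [A] remains. *)
Lemma circulation_outflow (R : numDomainType) (T : finType) (A : {pred T})
    (F : T -> T -> R) :
  (forall x y, F x y = - F y x) -> (forall x, \sum_y F x y = 0) ->
  \sum_(x in A) \sum_(y | y \notin A) F x y = 0.
Proof.
move=> antiF sumF; have : \sum_(x in A) \sum_y F x y = 0.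
  by rewrite big1 // => x _.
under eq_bigr => x _ do rewrite (bigID (mem A)) /=.
by rewrite big_split /= sum_antisymmetric // add0r.
Qed.

Lemma circulation_connect_rev (R : realDomainType) (T : finType) (e : rel T)
    (F : T -> T -> R) :
  (forall x y, F x y = - F y x) -> (forall x, \sum_y F x y = 0) ->
  (forall x y, e x y = (0 < F x y)) ->
  forall x y, e x y -> connect e y x.
Proof.
move=> antiF sumF eF x y exy; apply: contraT => nyx.
have outle0 u v : u \in connect e y -> v \notin connect e y -> F u v <= 0.
  move=> yu nyv; rewrite leNgt -eF; apply: contra nyv => euv.
  exact: connect_trans yu (connect1 euv).
have /eqP := circulation_outflow (connect e y) antiF sumF.
(* After negation a zero sum of nonnegative terms has only zero terms. Used twice, this isolates
   first the inner sum at [y], then its term at [x]. *)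
rewrite -oppr_eq0 -sumrN psumr_eq0 => [/allP /(_ y)|u yu]; last first.
  by rewrite oppr_ge0; apply: sumr_le0 => v; apply: outle0.
rewrite mem_index_enum inE connect0 => /(_ isT) /=.
rewrite -sumrN psumr_eq0 => [/allP /(_ x)|v nyv]; last first.
  by rewrite oppr_ge0; apply: outle0; rewrite // inE connect0.
rewrite mem_index_enum [x \in _]inE nyx -antiF => /(_ isT) /= /eqP Fxy0.
by move: exy; rewrite eF Fxy0 ltxx.
Qed.

(** Each edge of an unoriented path can be replaced by an oriented path, whichever way its arrow
    points. *)
Lemma connect_rev_strongly_connected (Q : quiver) :
  quiver_connected Q ->
  (forall i j : node Q, has_arrow i j -> connect (@has_arrow Q) j i) ->
  strongly_connected Q.
Proof.
move=> connQ revQ.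
suff all_conn i j : connect (@has_arrow Q) i j by [].
apply: connect_sub (connQ i j) => x y /orP[|/revQ //]; exact: connect1.
Qed.

Lemma has_arrow_quiver_of (n : nat) (kappa : 'M[int]_n) (i j : 'I_n) :
  @has_arrow (quiver_of kappa) i j = (0 < kappa i j).
Proof.
apply/existsP/idP => [[[[u v] k] /= /andP[/eqP <- /eqP <-]]|kpos].
  by case: k => k /=; rewrite /num_arrows /=; case: ifP.
have num_gt0 : (0 < num_arrows kappa (i, j))%N.
  by rewrite /num_arrows /= kpos absz_gt0 gt_eqF.
by exists (existT _ (i, j) (Ordinal num_gt0)); rewrite /= !eqxx.
Qed.

Lemma edistC (R : realType) (x y : 'rV[R]_3) : edist x y = edist y x.
Proof.
by congr Num.sqrt; apply: eq_bigr => k _; rewrite -sqrrN opprB.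
Qed.

Lemma edist_gt0 (R : realType) (x y : 'rV[R]_3) : x <> y -> 0 < edist x y.
Proof.
move=> neq_xy; rewrite sqrtr_gt0 lt_def sumr_ge0 => [|k _]; last exact: sqr_ge0.
rewrite andbT; apply/negP; rewrite psumr_eq0 => [/allP sq0|k _]; last exact: sqr_ge0.
apply: neq_xy; apply/rowP => k; apply/eqP.
by rewrite -subr_eq0 -sqrf_eq0; apply: sq0 (mem_index_enum k).
Qed.

(** Common form of both equations: [c i j] is [1 / r_ij] for scaling and [1 + 1 / r_ij] for
    attractor solutions. Positivity is asked only where [kappa i j != 0], since other centers may
    coincide, and then the inverse distance is 0. *)
Lemma weighted_balance_strongly_connected (R : realDomainType) (n : nat)
    (kappa : 'M[int]_n) (c : 'I_n -> 'I_n -> R) :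
  antisymmetric_mx kappa -> quiver_connected (quiver_of kappa) ->
  (forall i j, c i j = c j i) ->
  (forall i j, kappa i j != 0 -> 0 < c i j) ->
  (forall i, \sum_(j < n | (j != i) && (kappa i j != 0))
               (kappa i j)%:~R * c i j = 0) ->
  strongly_connected (quiver_of kappa).
Proof.
move=> anti conn csym cpos bal; apply: connect_rev_strongly_connected conn _.
apply: (circulation_connect_rev (F := fun i j => (kappa i j)%:~R * c i j)).
- by move=> i j; rewrite anti csym rmorphN mulNr.
- move=> i; rewrite -[RHS](bal i) [RHS]big_mkcond; apply: eq_bigr => j _.
  (* The terms omitted from the balance vanish; on the diagonal, antisymmetry forces
     [kappa i i = 0]. *)
  case: ifPn => // /nandP[/negPn/eqP ->|/negPn/eqP ->]; last by rewrite mul0r.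
  have /eqP := anti i i; rewrite eq_sym eqNr => /eqP ->.
  by rewrite mul0r.
- move=> i j; rewrite has_arrow_quiver_of.
  have [->|nz] := eqVneq (kappa i j) 0; first by rewrite mul0r !ltxx.
  by rewrite pmulr_lgt0 ?cpos // ltr0z.
Qed.

Theorem proposition2p1 (R : realType) (n : nat) (kappa : 'M[int]_n)
    (hanti : antisymmetric_mx kappa)
    (hconn : quiver_connected (quiver_of kappa))
    (hsol : (exists r : 'I_n -> 'rV[R]_3, scaling_solution kappa r) \/
            (exists r : 'I_n -> 'rV[R]_3, attractor_solution kappa r)) :
  strongly_connected (quiver_of kappa).
Proof.
case: hsol => [] [r [conf bal]];
  (* Unification with [bal] determines the weight [c]; its symmetry and positivity remain. *)
  apply: weighted_balance_strongly_connected hanti hconn _ _ bal => i j.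
- by rewrite edistC.
- by move/conf/edist_gt0; rewrite invr_gt0.
- by rewrite edistC.
- by move/conf/edist_gt0 => d_gt0; rewrite addr_gt0 ?divr_gt0.
Qed.
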